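(* Let $\mathcal{A}$ be a $C^*$-algebra, let $X$ and $Y$ be semi-inner product $\mathcal{A}$-modules, each normed by $|||x|||=\|[x,x]\|^{1/2}$, and let $T:X\to Y$ be a linear map. Then the following conditions are equivalent: (i) the operator $T$ is bounded and $\mathcal{A}$-linear, i.e. $T(xa)=(Tx)a$ for all $x\in X$, $a\in\mathcal{A}$; (ii) there exists a constant $K\geq 0$ such that for all $x\in X$ the operator inequality $[Tx,Tx]\leq K[x,x]$ holds in $\mathcal{A}$.
   Context: Right modules $X$ over a $C^*$-algebra $\mathcal{A}$ are complex vector spaces with compatible scalar multiplication, $\lambda(xa)=(\lambda x)a=x(\lambda a)$ for $\lambda\in\mathbb{C}$, $x\in X$, $a\in\mathcal{A}$ (and $x1=x$ if $\mathcal{A}$ has a unit $1$). For $a\in\mathcal{A}$, $|a|=(a^*a)^{1/2}$, and $\leq$ is the usual order on self-adjoint elements. $\mathcal{A}$ is not assumed unital, and $X$, $Y$ are not assumed complete. Linear means $\mathbb{C}$-linear. A semi-inner product $\mathcal{A}$-module is a right $\mathcal{A}$-module $X$ with a $C^*$-semi-inner product, i.e. a mapping $[\cdot,\cdot]:X\times X\to\mathcal{A}$ such that: (i) $[x,x]\geq 0$ for all $x\in X$, and $[x,x]=0$ implies $x=0$; (ii) $[x,\alpha y_1+\beta y_2]=\alpha[x,y_1]+\beta[x,y_2]$ for all $x,y_1,y_2\in X$ and $\alpha,\beta\in\mathbb{C}$; (iii) $[x,ya]=[x,y]a$ and $[xa,y]=a^*[x,y]$ for all $x,y\in X$ and $a\in\mathcal{A}$;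 (iv) $|[y,x]|^2\leq \|[y,y]\|\,[x,x]$ for all $x,y\in X$. (No additivity in the first variable is assumed.) The function $|||\cdot|||$ is a norm. *)

(* Defs.v *)
From HB Require Import structures.
From mathcomp Require Import all_boot all_order all_algebra.
From mathcomp Require Import complex.
From mathcomp Require Import all_classical all_reals all_analysis.

Set Implicit Arguments.
Unset Strict Implicit.
Unset Printing Implicit Defensive.

Import Order.TTheory GRing.Theory Num.Theory.
Import numFieldNormedType.Exports.

Local Open Scope classical_set_scope.
Local Open Scope ring_scope.
Local Open Scope complex_scope.

(* The algebra need not have a unit, so the ring structures of MathComp, which
   are all unital, do not apply; the norm takes its values in the nonnegative
   reals of R[i]. Isometry of the involution follows from cstar_normP. *)
HB.mixin Record isCStarAlgebra (R : realType) A
    of CompleteNormedModule R[i] A := {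
  cmul : A -> A -> A;
  cstar : A -> A;
  cmulA : associative cmul;
  cmulDl : left_distributive cmul +%R;
  cmulDr : right_distributive cmul +%R;
  cmulZl : forall (l : R[i]) (a b : A), cmul (l *: a) b = l *: cmul a b;
  cmulZr : forall (l : R[i]) (a b : A), cmul a (l *: b) = l *: cmul a b;
  cmul_normP : forall a b : A, `|cmul a b| <= `|a| * `|b|;
  cstarK : involutive cstar;
  cstarD : {morph cstar : a b / a + b};
  cstarZ : forall (l : R[i]) (a : A), cstar (l *: a) = l^* *: cstar a;
  cstarM : forall a b : A, cstar (cmul a b) = cmul (cstar b) (cstar a);
  cstar_normP : forall a : A, `|cmul (cstar a) a| = `|a| ^+ 2
}.

#[short(type="cstarAlgType")]
HB.structure Definition CStarAlgebra (R : realType) :=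
  { A of isCStarAlgebra R A & CompleteNormedModule R[i] A }.

Declare Scope cstar_scope.
Delimit Scope cstar_scope with cstar.
Local Open Scope cstar_scope.
Notation "a ** b" := (cmul a b) (at level 40, left associativity) : cstar_scope.
Notation "a ^#" := (cstar a) (at level 2, format "a ^#") : cstar_scope.

Section Order.
Context {R : realType} {A : cstarAlgType R}.
Implicit Types a b : A.

Definition cpos a : Prop := exists b, a = b^# ** b.

Definition cle a b : Prop := cpos (b - a).

(* The positive square root, which exists and is unique as soon as cpos a. *)
Definition csqrt a : A := xget 0 [set s | cpos s /\ s ** s = a].

Definition cabs a : A := csqrt (a^# ** a).

End Order.

Notation "a <=* b" := (cle a b) (at level 70, no associativity) : cstar_scope.

HB.mixin Record isRightModule (R : realType) (A : cstarAlgType R) X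
    of GRing.Lmodule R[i] X := {
  ract : X -> A -> X;
  ractDl : forall (x y : X) (a : A), ract (x + y) a = ract x a + ract y a;
  ractDr : forall (x : X) (a b : A), ract x (a + b) = ract x a + ract x b;
  ractA : forall (x : X) (a b : A), ract x (a ** b) = ract (ract x a) b;
  ractZl : forall (l : R[i]) (x : X) (a : A), l *: ract x a = ract (l *: x) a;
  ractZr : forall (l : R[i]) (x : X) (a : A), l *: ract x a = ract x (l *: a);
  ract1 : forall e : A, (forall a : A, e ** a = a /\ a ** e = a) ->
    forall x : X, ract x e = x
}.

#[short(type="rightModType")]
HB.structure Definition RightModule (R : realType) (A : cstarAlgType R) :=
  { X of isRightModule R A X & GRing.Lmodule R[i] X }.

Notation "x *>> a" := (ract x a) (at level 40, left associativity) : cstar_scope.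

HB.mixin Record isSemiInnerProduct (R : realType) (A : cstarAlgType R) X
    of RightModule R A X := {
  sip : X -> X -> A;
  sip_ge0 : forall x : X, 0 <=* sip x x;
  sip_eq0 : forall x : X, sip x x = 0 -> x = 0;
  sip_linr : forall (x y z : X) (l m : R[i]),
    sip x (l *: y + m *: z) = l *: sip x y + m *: sip x z;
  sip_actr : forall (x y : X) (a : A), sip x (ract y a) = sip x y ** a;
  sip_actl : forall (x y : X) (a : A), sip (ract x a) y = a^# ** sip x y;
  sip_CauchySchwarz : forall x y : X,
    cabs (sip y x) ** cabs (sip y x) <=* `|sip y y| *: sip x x
}.

#[short(type="sipModType")]
HB.structure Definition SemiInnerProductModule
    (R : realType) (A : cstarAlgType R) :=
  { X of isSemiInnerProduct R A X & RightModule R A X }.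

Definition sip_norm (R : realType) (A : cstarAlgType R) (X : sipModType A)
  (x : X) : R[i] := sqrtC `|sip x x|.

Definition sip_bounded (R : realType) (A : cstarAlgType R) (X Y : sipModType A)
  (T : X -> Y) : Prop :=
  exists M : R, forall x : X, sip_norm (T x) <= M%:C * sip_norm x.

(* Main.v *)
(* Since A may lack a unit, elements [t + a] of its unitization act on A by left
   multiplication, and [a = a^#] counts as positive when the operator [t - a]
   has norm at most t for some t > 0. Square roots come from the iteration
   [y' = (x + y^2) / 2], and Kaplansky's argument shows that every [b^# ** b] is
   positive in this sense.
   If T is bounded and A-linear, then [|a^# p a| <= M |a^# q a|] for
   [p = [Tx, Tx]] and [q = [x, x]]; taking for a the negative part of
   [(M + 1) q - p] forces that part to vanish.
   Conversely, [Tx, Tx] <= K [x, x] bounds [F u c = [z, T(u) c]] by a multiple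
   of the norm of d whenever [u c = x d]. For u = x (1 + l h)^n and
   c = (1 - l h)^n b this yields d = (1 - l^2 h^2)^n b, which stays bounded on
   the circle of radius n^(-1/2), so by Cauchy's estimate the coefficient
   [n (F (x h) b - F x (h b))] of l is at most of order n^(1/2). Hence
   T(xh) b = T(x) h b for all b. *)

Require Import Defs.
From HB Require Import structures.
From mathcomp Require Import all_boot all_order all_algebra.
From mathcomp Require Import all_solvable all_field.
From mathcomp Require Import complex ring lra.
From mathcomp Require Import all_classical all_reals all_analysis.

Set Implicit Arguments.
Unset Strict Implicit.
Unset Printing Implicit Defensive.

Import Order.TTheory GRing.Theory Num.Theory.
Import numFieldNormedType.Exports.

Local Open Scope ring_scope.
Local Open Scope complex_scope.
Local Open Scope cstar_scope.

(* K * V with V * V = 0 is a commutative ring in which [v |-> (0, v)] turns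
   scaling into multiplication: [ring] there decides linear identities in V. *)
Definition sqzero (K : comNzRingType) (V : lmodType K) : Type := (K * V)%type.

(** * The square-zero extension of a module *)

Section SquareZero.
Variables (K : comNzRingType) (V : lmodType K).
Local Notation S := (sqzero V).

HB.instance Definition _ := GRing.Zmodule.copy S (K * V)%type.

Definition sqzero_mul (x y : S) : S := (x.1 * y.1, x.1 *: y.2 + y.1 *: x.2).

Definition sqzero_one : S := (1, 0).

Lemma sqzero_mulA : associative sqzero_mul.
Proof.
case=> a u [b v] [c w]; congr pair => /=; first by rewrite mulrA.
rewrite !scalerDr !scalerA addrA; congr (_ + _ *: _ + _ *: _).
  by rewrite mulrC.
by rewrite mulrC.
Qed.

Lemma sqzero_mulC : commutative sqzero_mul.
Proof. by case=> a u [b v]; rewrite /sqzero_mul /= mulrC addrC. Qed.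

Lemma sqzero_mul1 : left_id sqzero_one sqzero_mul.
Proof. by case=> a u; rewrite /sqzero_mul /= mul1r scale1r scaler0 addr0. Qed.

Lemma sqzero_mulD : left_distributive sqzero_mul +%R.
Proof.
case=> a u [b v] [c w]; congr pair => /=; first by rewrite mulrDl.
by rewrite scalerDl scalerDr addrACA.
Qed.

Lemma sqzero_one_neq0 : sqzero_one != 0.
Proof. by apply/eqP => -[] /eqP; rewrite oner_eq0. Qed.

HB.instance Definition _ := GRing.Zmodule_isComNzRing.Build S
  sqzero_mulA sqzero_mulC sqzero_mul1 sqzero_mulD sqzero_one_neq0.

Definition sqz_scalar (k : K) : S := (k, 0).
Definition sqz_vector (v : V) : S := (0, v).

Lemma sqz_scalar_additive : additive sqz_scalar.
Proof. by move=> a b; congr pair; rewrite subr0. Qed.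

Lemma sqz_scalar_multiplicative : multiplicative sqz_scalar.
Proof.
by split=> // a b; congr pair; rewrite /= !scaler0 addr0.
Qed.

HB.instance Definition _ := GRing.isAdditive.Build K S sqz_scalar
  sqz_scalar_additive.
HB.instance Definition _ := GRing.isMultiplicative.Build K S sqz_scalar
  sqz_scalar_multiplicative.

Lemma sqz_vector_inj (u v : V) : sqz_vector u = sqz_vector v -> u = v.
Proof. by case. Qed.

Lemma sqz_vectorD (u v : V) : sqz_vector (u + v) = sqz_vector u + sqz_vector v.
Proof. by congr pair; rewrite addr0. Qed.

Lemma sqz_vectorN (u : V) : sqz_vector (- u) = - sqz_vector u.
Proof. by congr pair; rewrite oppr0. Qed.

Lemma sqz_vector0 : sqz_vector 0 = 0.
Proof. by []. Qed.

Lemma sqz_vectorZ (k : K) (v : V) :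
  sqz_vector (k *: v) = sqz_scalar k * sqz_vector v.
Proof. by congr pair; rewrite /= ?mulr0 // scale0r addr0. Qed.

Lemma sqz_vectorMn (v : V) n : sqz_vector (v *+ n) = sqz_vector v *+ n.
Proof.
elim: n => [|n IHn]; first by [].
by rewrite !mulrS sqz_vectorD IHn.
Qed.

End SquareZero.

Definition sqzE := (sqz_vectorD, sqz_vectorN, sqz_vector0, sqz_vectorZ,
  sqz_vectorMn).

Ltac module := apply: sqz_vector_inj; rewrite !sqzE; ring.

(** * Elementary norm estimates in a non-unital C*-algebra *)

Section CStarBasics.
Context {R : realType} {A : cstarAlgType R}.
Implicit Types (a b c : A) (k l : R).

Lemma cmul0l a : 0 ** a = 0.
Proof. by apply: (addIr (0 ** a)); rewrite -cmulDl !add0r. Qed.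

Lemma cmul0r a : a ** 0 = 0.
Proof. by apply: (addIr (a ** 0)); rewrite -cmulDr !add0r. Qed.

Lemma cmulNl a b : (- a) ** b = - (a ** b).
Proof. by apply/eqP; rewrite -addr_eq0 -cmulDl addNr cmul0l. Qed.

Lemma cmulNr a b : a ** (- b) = - (a ** b).
Proof. by apply/eqP; rewrite -addr_eq0 -cmulDr addNr cmul0r. Qed.

Lemma cmulMnl a b n : (a *+ n) ** b = a ** b *+ n.
Proof. by elim: n => [|n IHn]; rewrite ?cmul0l // !mulrS cmulDl IHn. Qed.

Lemma cmulMnr a b n : a ** (b *+ n) = a ** b *+ n.
Proof. by elim: n => [|n IHn]; rewrite ?cmul0r // !mulrS cmulDr IHn. Qed.

Lemma cstar0 : (0 : A)^# = 0.
Proof. by apply: (addIr ((0 : A)^#)); rewrite -cstarD !add0r. Qed.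

Lemma cstarN a : (- a)^# = - a^#.
Proof. by apply/eqP; rewrite -addr_eq0 -cstarD addNr cstar0. Qed.

Lemma cstarMn a n : (a *+ n)^# = a^# *+ n.
Proof. by elim: n => [|n IHn]; rewrite ?cstar0 // !mulrS cstarD IHn. Qed.

Lemma cstarZR k a : (k%:C *: a)^# = k%:C *: a^#.
Proof. by rewrite cstarZ; congr (_ *: _); exact: conjc_real. Qed.

Lemma cstarZi a : ('i *: a)^# = - ('i *: a^#).
Proof.
rewrite cstarZ -scaleNr; congr (_ *: _); apply: (_ : conjc _ = _).
by apply/eqP; rewrite eq_complex /= oppr0 !eqxx.
Qed.

(** The norm is a nonnegative element of [R[i]], hence real; its copy in [R] is open to [lra] and
    [nra]. *)
Definition nm a : R := complex.Re `|a|.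

Lemma nmE a : `|a| = (nm a)%:C.
Proof.
have /ger0_Im := normr_ge0 a.
by rewrite /nm; case: `|a| => x y /= ->.
Qed.

Lemma nm_ge0 a : 0 <= nm a.
Proof. by rewrite -ler0c -nmE. Qed.

Lemma nm0 : nm 0 = 0.
Proof. by rewrite /nm normr0. Qed.

Lemma nm_eq0 a : nm a = 0 -> a = 0.
Proof. by move=> h; apply/eqP; rewrite -normr_eq0 nmE h. Qed.

Lemma nm_le0 a : nm a <= 0 -> a = 0.
Proof. by move=> h; apply: nm_eq0; apply/le_anti; rewrite h nm_ge0. Qed.

Lemma nmD a b : nm (a + b) <= nm a + nm b.
Proof. by rewrite -lecR rmorphD /= -!nmE ler_normD. Qed.

Lemma nmN a : nm (- a) = nm a.
Proof. by rewrite /nm normrN. Qed.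

Lemma nmB a b : nm (a - b) <= nm a + nm b.
Proof. by rewrite -(nmN b) nmD. Qed.

Lemma nmZ (z : R[i]) a : nm (z *: a) = complex.Re `|z| * nm a.
Proof.
apply: complexI; rewrite -nmE normrZ nmE rmorphM /=.
by rewrite normc_def; case: z.
Qed.

Lemma nmZR k a : nm (k%:C *: a) = `|k| * nm a.
Proof. by rewrite nmZ normc_def /= expr0n addr0 sqrtr_sqr. Qed.

Lemma nmZi a : nm ('i *: a) = nm a.
Proof. by rewrite nmZ normc_def /= expr0n expr1n add0r sqrtr1 mul1r. Qed.

Lemma nmM a b : nm (a ** b) <= nm a * nm b.
Proof. by rewrite -lecR rmorphM /= -!nmE cmul_normP. Qed.

Lemma nm_starM a : nm (a^# ** a) = nm a ^+ 2.
Proof. by apply: complexI; rewrite rmorphXn /= -!nmE cstar_normP. Qed.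

Lemma nm_star a : nm a^# = nm a.
Proof.
suff le_star b : nm b <= nm b^#.
  by apply/le_anti; rewrite le_star andbT -{2}(cstarK a) le_star.
have [->|b_neq0] := eqVneq (nm b) 0; first exact: nm_ge0.
have b_gt0 : 0 < nm b by rewrite lt0r b_neq0 nm_ge0.
by rewrite -(ler_pM2r b_gt0) -expr2 -nm_starM nmM.
Qed.

Lemma nm_sqr a : a^# = a -> nm (a ** a) = nm a ^+ 2.
Proof. by move=> sa; rewrite -nm_starM sa. Qed.


(** Testing the bound on [a^#] gives [nm a ^+ 2 <= k * nm a]. Norms of elements can thus be read off
    from their left multiplications. *)
Lemma nm_le_op a k : 0 <= k -> (forall b, nm (a ** b) <= k * nm b) ->
  nm a <= k.
Proof.
move=> k_ge0 op_a; have [->//|a_neq0] := eqVneq (nm a) 0.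
have a_gt0 : 0 < nm a by rewrite lt0r a_neq0 nm_ge0.
have := op_a a^#; rewrite -{1}[a]cstarK nm_starM nm_star expr2.
by rewrite ler_pM2r.
Qed.

Lemma cmul_starl_eq0 a : a^# ** a = 0 -> a = 0.
Proof.
move=> h; apply: nm_eq0; apply/eqP; rewrite -sqrf_eq0 -nm_starM h.
by rewrite nm0.
Qed.

Lemma cmul_sqr_eq0 a : a^# = a -> a ** a = 0 -> a = 0.
Proof. by move=> sa aa0; apply: cmul_starl_eq0; rewrite sa. Qed.

Lemma cabsorb_eq0 a : (forall b, a ** b = 0) -> a = 0.
Proof.
move=> h; rewrite -[a]cstarK (cmul_starl_eq0 (a := a^#)) ?cstar0 //.
by rewrite cstarK.
Qed.

Lemma nm_lim0 a (e : nat -> R) (K : R) : 0 <= K ->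
  (forall n, nm a <= K * e n) ->
  (forall eps, 0 < eps -> exists n, e n < eps) -> a = 0.
Proof.
move=> K_ge0 le_a e_lim; apply: nm_le0; apply/ler_addgt0Pl => eps eps_gt0.
have K1_gt0 : 0 < K + 1 by lra.
have [n en] := e_lim (eps / (K + 1)) (divr_gt0 eps_gt0 K1_gt0).
rewrite addr0; apply: le_trans (le_a n) _.
rewrite ltr_pdivlMr // in en.
have [en0|en0] := lerP 0 (e n); nra.
Qed.

Lemma cauchy_lim (u : nat -> A) (e : nat -> R) :
  (forall m n, (m <= n)%N -> nm (u n - u m) <= e m) ->
  (forall eps, 0 < eps -> exists n, e n < eps) ->
  exists v, forall n, nm (v - u n) <= e n.
Proof.
move=> u_cauchy e_lim.
have/cauchy_cvg/cvg_ex [v u_v] : cauchy (u @ \oo)%classic.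
  (* A positive radius in [R[i]] has imaginary part 0. *)
  apply: cauchy_exP => -[eps z]; rewrite ltcE /= => /andP[/eqP ->] eps_gt0.
  have [m em] := e_lim _ eps_gt0.
  exists (u m); exists m => // n /= mn.
  rewrite -ball_normE /= nmE; apply: (_ : _ < eps%:C); rewrite ltcR.
  by apply: le_lt_trans em; rewrite -nmN opprB u_cauchy.
exists v => m; apply/ler_addgt0Pr => eps eps_gt0.
have epsC_gt0 : 0 < eps%:C :> R[i] by rewrite ltcR.
have/cvgrPdist_lt/(_ _ epsC_gt0) [n0 _ near_v] := u_v.
have := near_v (maxn m n0) (leq_maxr _ _).
rewrite /= nmE ltcR => lt_eps.
rewrite -(subrKA (u (maxn m n0)) v) addrC; apply: le_trans (nmD _ _) _.
by rewrite lerD ?(ltW lt_eps) // u_cauchy // leq_maxl.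
Qed.

End CStarBasics.

Definition cmulE {R : realType} {A : cstarAlgType R} :=
  (@cmulDl R A, @cmulDr R A, @cmulNl R A, @cmulNr R A, @cmulZl R A,
   @cmulZr R A, @cmulMnl R A, @cmulMnr R A, @cmulA R A, @cmul0l R A,
   @cmul0r R A).

Definition cstarE {R : realType} {A : cstarAlgType R} :=
  (@cstarD R A, @cstarN R A, @cstarMn R A, @cstarZR R A, @cstarZi R A,
   @cstarM R A, @cstarK R A, @cstar0 R A).

Ltac cstar_ring := rewrite ?cmulE; module.

(* The scalar majorant of the iteration [y' = (x + y^2) / 2] for [|x| <= 1],
   whose limit y satisfies [(1 - y)^2 = 1 - x]. *)
Fixpoint majorant (R : realType) (n : nat) : R :=
  if n is m.+1 then (1 + majorant R m ^+ 2) / 2 else 0.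

(** * Monotonicity and rate of convergence of the scalar majorant *)

Section Majorant.
Variable R : realType.
Local Notation Y := (majorant R).

Lemma majorantS n : Y n.+1 *+ 2 = 1 + Y n ^+ 2.
Proof. by rewrite /=; lra. Qed.

Lemma majorant_bounds n : 0 <= Y n <= 1.
Proof.
elim: n => [|n /andP[Y_ge0 Y_le1]] /=; first by rewrite lexx ler01.
by apply/andP; split; nra.
Qed.

Lemma majorant_ge0 n : 0 <= Y n.
Proof. by case/andP: (majorant_bounds n). Qed.

Lemma majorant_le1 n : Y n <= 1.
Proof. by case/andP: (majorant_bounds n). Qed.

Lemma majorant_leS n : Y n <= Y n.+1.
Proof. by have := majorantS n; have := sqr_ge0 (Y n - 1); nra. Qed.

(** The gap [e = 1 - Y n] obeys [e' = e - e ^+ 2 / 2], which decays like [2 / n]; the shift to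
    [n.+2] gives equality at [n = 0]. *)
Lemma majorant_gap n : (1 - Y n) * n.+2%:R <= 2.
Proof.
elim: n => [|n IHn]; first by rewrite /=; lra.
have := majorantS n; have := majorant_bounds n.
move: IHn; rewrite [n.+3%:R]mulrS [n.+2%:R]mulrS.
set t := n.+1%:R; set y := Y n; have t_ge1 : 1 <= t by rewrite ler1n.
move=> le_t /andP[y_ge0 y_le1] eqY.
have -> : 1 - Y n.+1 = (1 - y) - (1 - y) ^+ 2 / 2 by nra.
set e := 1 - y in le_t *.
have [e_ge0 e_le1] : 0 <= e /\ e <= 1 by rewrite /e; lra.
set s := 1 + t in le_t *; have s_ge2 : 2 <= s by rewrite /s; lra.
nra.
Qed.

Lemma majorant_lim eps : 0 < eps -> exists n, 1 - Y n < eps.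
Proof.
move=> eps_gt0; have [n n_gt] : exists n, 2 / eps < n%:R :> R.
  exists (Num.truncn (2 / eps)).+1; exact: truncnS_gt.
exists n; have := majorant_gap n; rewrite !mulrS.
rewrite ltr_pdivrMr // in n_gt.
have := majorant_le1 n; set y := Y n; set t := n%:R in n_gt *.
have t_ge0 : 0 <= t by rewrite ler0n.
nra.
Qed.

End Majorant.

(** * Square roots in the unitization by iteration *)

Section RootIteration.
Context {R : realType} {A : cstarAlgType R}.
Implicit Types (a b c u : A).
Local Notation Y := (majorant R).

(* Left multiplication by the element [k + u] of the unitization of A. *)
Definition unital_act (k : R) u b : A := k%:C *: b + u ** b.

Lemma scale_half b : (2^-1)%:C *: (b *+ 2) = b.
Proof.
rewrite -scalerMnr scalerMnl -rmorphMn /= -mulr_natr mulVf ?pnatr_eq0 //.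
by rewrite rmorph1 scale1r.
Qed.

(* [w + a] is an element of the unitization; below w is an idempotent scalar,
   that is 0 or 1, so that the scalar part of the n-th iterate is [w * Y n]. *)
Variables (w : R) (a : A).

Fixpoint root_iter (n : nat) : A :=
  if n is m.+1 then
    (2^-1)%:C *: (a + (w * Y m *+ 2)%:C *: root_iter m
                    + root_iter m ** root_iter m)
  else 0.

Local Notation u := root_iter.
Local Notation act := unital_act.

Lemma root_iterS n :
  u n.+1 *+ 2 = a + (w * Y n *+ 2)%:C *: u n + u n ** u n.
Proof. by rewrite /= scalerMnr scale_half. Qed.

Lemma nm_half (b c : A) k : b *+ 2 = c -> nm c <= k *+ 2 -> nm b <= k.
Proof.
move=> <-; have -> : b *+ 2 = 2%:C *: b by module.
by rewrite nmZR ger0_norm //; lra.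
Qed.

Hypothesis a_sa : a^# = a.

Lemma root_iter_sa n : (u n)^# = u n.
Proof.
elim: n => [|n IHn]; first exact: cstar0.
by rewrite /= !cstarE a_sa IHn.
Qed.

Lemma root_iter_comm c n : a ** c = c ** a -> u n ** c = c ** u n.
Proof.
move=> ac; elim: n => [|n IHn] /=; first by rewrite cmul0l cmul0r.
by rewrite !cmulE ac -[u n ** u n ** c]cmulA IHn cmulA IHn.
Qed.

Lemma root_iter_commC m n : u n ** u m = u m ** u n.
Proof. by apply: root_iter_comm; rewrite root_iter_comm. Qed.

Hypothesis ww : w * w = w.
Hypothesis wa_le1 : forall b, nm (act w a b) <= nm b.

Lemma idem_bounds : 0 <= w <= 1.
Proof. by apply/andP; split; have := ww; nra. Qed.

(** The element [y = w * Y n + u n] satisfies [2 y' = (w + a) + y^2], so the bounds on the operator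
    norms follow the recursion of [Y]. *)
Lemma root_iter_le n b : nm (act (w * Y n) (u n) b) <= Y n * nm b.
Proof.
elim: n b => [|n IHn] b.
  by rewrite /act /= mulr0 mul0r cmul0l scale0r addr0 nm0.
apply: (@nm_half _ (act w a b + act (w * Y n) (u n) (act (w * Y n) (u n) b))).
  rewrite /act mulrnDl -cmulMnl root_iterS.
  have -> : (w * Y n.+1)%:C *: b *+ 2 = (w + (w * Y n) ^+ 2)%:C *: b.
    have -> : w + (w * Y n) ^+ 2 = w * Y n.+1 *+ 2.
      by rewrite -mulrnAr majorantS exprMn expr2 ww mulrDr mulr1.
    by module.
  by cstar_ring.
apply: le_trans (nmD _ _) _.
have le1 := wa_le1 b; have le2 := IHn (act (w * Y n) (u n) b).
have le3 := IHn b; have Y_ge0 := majorant_ge0 R n.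
rewrite -mulrnAl majorantS mulrDl mul1r lerD //; apply: le_trans le2 _.
by rewrite expr2 -mulrA ler_wpM2l.
Qed.

(** As the iterates commute, [2 (y'' - y') = (y' - y) (y' + y)], and the majorant satisfies the same
    identity. *)
Lemma root_iter_stepS n b :
  nm (act (w * (Y n.+1 - Y n)) (u n.+1 - u n) b) <= (Y n.+1 - Y n) * nm b.
Proof.
elim: n b => [|n IHn] b.
  apply: (@nm_half _ (act w a b)); last first.
    by rewrite -mulrnAl mulrnBl majorantS mul0rn expr0n /= addr0 subr0 mul1r.
  have -> : act w a b = act (w * (Y 1 - Y 0) *+ 2) a b.
    by congr act; rewrite /=; field.
  by rewrite /act mulrnDl -cmulMnl mulrnBl root_iterS; cstar_ring.
set S := act (w * (Y n.+1 + Y n)) (u n.+1 + u n) b.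
have S_le : nm S <= (Y n.+1 + Y n) * nm b.
  rewrite mulrDl; apply: le_trans (lerD (root_iter_le _ b) (root_iter_le _ b)).
  apply: le_trans (nmD _ _); rewrite /S /act.
  by rewrite le_eqVlt; apply/orP; left; apply/eqP; congr nm; cstar_ring.
apply: (@nm_half _ (act (w * (Y n.+1 - Y n)) (u n.+1 - u n) S)).
  rewrite /S /act mulrnDl -cmulMnl mulrnBl !root_iterS.
  have comm := root_iter_commC n n.+1.
  have -> : (w * (Y n.+2 - Y n.+1))%:C *: b *+ 2 =
            ((w * Y n.+1) ^+ 2 - (w * Y n) ^+ 2)%:C *: b.
    have -> : (w * Y n.+1) ^+ 2 - (w * Y n) ^+ 2 = w * (Y n.+2 - Y n.+1) *+ 2.
      rewrite -mulrnAr mulrnBl !majorantS !exprMn !expr2 ww; ring.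
    by module.
  move: comm; move: (u n.+1) (u n) => p q comm.
  by rewrite !cmulE comm; module.
apply: le_trans (IHn S) _.
have : 0 <= Y n.+1 - Y n by rewrite subr_ge0 majorant_leS.
move=> d_ge0; apply: le_trans (ler_wpM2l d_ge0 S_le) _.
rewrite -mulrnAl mulrnBl !majorantS mulrA -subr_sqr.
by rewrite opprD addrACA subrr add0r.
Qed.

Lemma root_iter_step m n b : (m <= n)%N ->
  nm (act (w * (Y n - Y m)) (u n - u m) b) <= (Y n - Y m) * nm b.
Proof.
move=> /subnKC <-; elim: (n - m)%N => [|k IHk].
  by rewrite addn0 !subrr /act mulr0 mul0r scale0r cmul0l addr0 nm0.
rewrite addnS.
have -> : act (w * (Y (m + k).+1 - Y m)) (u (m + k).+1 - u m) b =
   act (w * (Y (m + k).+1 - Y (m + k))) (u (m + k).+1 - u (m + k)) b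
   + act (w * (Y (m + k) - Y m)) (u (m + k) - u m) b.
  by rewrite /act; cstar_ring.
have := nmD (act (w * (Y (m + k).+1 - Y (m + k))) (u (m + k).+1 - u (m + k)) b)
  (act (w * (Y (m + k) - Y m)) (u (m + k) - u m) b).
have := root_iter_stepS (m + k) b; move: IHk; lra.
Qed.

Lemma root_iter_cauchy m n : (m <= n)%N -> nm (u n - u m) <= (1 - Y m) *+ 2.
Proof.
move=> mn; have Ym1 := majorant_le1 R m.
apply: nm_le_op => [|b]; first by rewrite mulrn_wge0 ?subr_ge0.
(* Removing the scalar part costs a second [1 - Y m], hence the factor 2. *)
have -> : (u n - u m) ** b = act (w * (Y n - Y m)) (u n - u m) b
    - (w * (Y n - Y m))%:C *: b by rewrite /act; cstar_ring.
apply: le_trans (nmB _ _) _; have step := root_iter_step b mn.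
have d_ge0 : 0 <= Y n - Y m.
  rewrite subr_ge0; move: mn => /subnKC <-; elim: (n - m)%N => [|k IHk].
    by rewrite addn0.
  by rewrite addnS (le_trans IHk) ?majorant_leS.
have /andP[w_ge0 w_le1] := idem_bounds; have b_ge0 := nm_ge0 b.
rewrite nmZR ger0_norm ?mulr_ge0 //.
have le_w : w * (Y n - Y m) * nm b <= (Y n - Y m) * nm b.
  by rewrite -mulrA ler_piMl ?mulr_ge0.
have : (Y n - Y m) * nm b <= (1 - Y m) * nm b.
  by rewrite ler_wpM2r // lerB // majorant_le1.
rewrite mulrnAl mulr2n; lra.
Qed.

(* The third equation says that [y = w + v] solves [2 y = (w + a) + y^2]. *)
Lemma root_exists : exists v,
  [/\ v^# = v,
      forall b, nm (act w v b) <= nm b,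
      v *+ 2 = a + (w *+ 2)%:C *: v + v ** v &
      forall c, a ** c = c ** a -> v ** c = c ** v].
Proof.
have e_lim eps : 0 < eps -> exists n, (1 - Y n) *+ 2 < eps.
  move=> eps_gt0; have [n lt_n] := majorant_lim (divr_gt0 eps_gt0 (ltr0Sn R 1)).
  by exists n; lra.
have [v v_lim] := cauchy_lim root_iter_cauchy e_lim.
have /andP[w_ge0 w_le1] := idem_bounds.
have YP n := majorant_bounds R n.
exists v; split.
- apply/eqP; rewrite -subr_eq0; apply/eqP.
  apply: (@nm_lim0 _ _ _ (fun n => (1 - Y n) *+ 2) 2) => // n.
  have -> : v^# - v = (v - u n)^# - (v - u n).
    by rewrite !cstarE root_iter_sa; module.
  apply: le_trans (nmB _ _) _; rewrite nm_star; have := v_lim n; lra.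
- move=> b; apply/ler_addgt0Pr => eps eps_gt0.
  (* The error terms below add up to at most [3 * (1 - Y n) * nm b]; the [+ 1] keeps the divisor
     positive. *)
  have b_ge0 := nm_ge0 b; have b1_gt0 : 0 < 3 * (nm b + 1) by lra.
  have [n] := e_lim _ (divr_gt0 eps_gt0 b1_gt0).
  rewrite ltr_pdivlMr // => en.
  have -> : act w v b = act (w * Y n) (u n) b
      + ((w * (1 - Y n))%:C *: b + (v - u n) ** b) by rewrite /act; cstar_ring.
  have /andP[Y_ge0 Y_le1] := YP n.
  have w1_ge0 : 0 <= w * (1 - Y n) by rewrite mulr_ge0 ?subr_ge0.
  have le1 := root_iter_le n b.
  have le2 := nmM (v - u n) b; have le3 := v_lim n.
  have le4 : nm (v - u n) * nm b <= (1 - Y n) *+ 2 * nm b by rewrite ler_wpM2r.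
  have le5 : Y n * nm b <= nm b by rewrite ler_piMl.
  have le6 : w * (1 - Y n) * nm b <= (1 - Y n) * nm b.
    by rewrite -mulrA ler_piMl ?mulr_ge0 ?subr_ge0.
  apply: le_trans (nmD _ _) _.
  have := nmD ((w * (1 - Y n))%:C *: b) ((v - u n) ** b).
  rewrite nmZR ger0_norm // => le7.
  have : (1 - Y n) *+ 2 * (3 * (nm b + 1)) =
      (1 - Y n) * nm b * 6 + (1 - Y n) * 6 by ring.
  have : 0 <= (1 - Y n) * nm b by rewrite mulr_ge0 ?subr_ge0.
  lra.
- apply/eqP; rewrite -subr_eq0; apply/eqP.
  (* Five error terms arise: [n4] contributes the summand [nm v], the four others at most
     [(1 - Y n) * 4] each. *)
  apply: (@nm_lim0 _ _ _ (fun n => (1 - Y n) *+ 2) (10 + nm v)) => [|n|//].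
    by have := nm_ge0 v; lra.
  have eqv : v *+ 2 - (a + (w *+ 2)%:C *: v + v ** v) =
     (v - u n.+1) *+ 2
     - ((w *+ 2)%:C *: (v - u n) + (w * (1 - Y n) *+ 2)%:C *: u n
       + ((v - u n) ** v + u n ** (v - u n))).
    by rewrite mulrnBl root_iterS; cstar_ring.
  have /andP[Y_ge0 Y_le1] := YP n; have /andP[_ Y1_le1] := YP n.+1.
  (* Comparison with [u 0 = 0], where [Y 0 = 0]. *)
  have un_le : nm (u n) <= 2.
    have := root_iter_cauchy (leq0n n); rewrite /= subr0 => /le_trans; apply.
    by rewrite subr0.
  have vn := v_lim n; have vn1 := v_lim n.+1; have leY := majorant_leS R n.
  have v_ge0 := nm_ge0 v; have d_ge0 := nm_ge0 (v - u n).
  have un_ge0 := nm_ge0 (u n).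
  have n1 : nm ((v - u n.+1) *+ 2) <= (1 - Y n) * 4.
    by apply: le_trans (nmD _ _) _; lra.
  have n2 : nm ((w *+ 2)%:C *: (v - u n)) <= (1 - Y n) * 4.
    by rewrite nmZR ger0_norm ?mulrn_wge0 //; nra.
  have n3 : nm ((w * (1 - Y n) *+ 2)%:C *: u n) <= (1 - Y n) * 4.
    rewrite nmZR ger0_norm; last by rewrite mulrn_wge0 // mulr_ge0 ?subr_ge0.
    apply: (@le_trans _ _ ((1 - Y n) *+ 2 * 2)); last by lra.
    rewrite ler_pM ?mulrn_wge0 ?mulr_ge0 ?subr_ge0 //.
    by rewrite lerMn2r ler_piMl ?subr_ge0.
  have n4 : nm ((v - u n) ** v) <= (1 - Y n) *+ 2 * nm v.
    by apply: le_trans (nmM _ _) _; rewrite ler_wpM2r.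
  have n5 : nm (u n ** (v - u n)) <= (1 - Y n) * 4.
    apply: le_trans (nmM _ _) _.
    apply: (@le_trans _ _ (2 * ((1 - Y n) *+ 2))); last by lra.
    by rewrite ler_pM.
  rewrite eqv; apply: le_trans (nmB _ _) _.
  have := nmD ((w *+ 2)%:C *: (v - u n) + (w * (1 - Y n) *+ 2)%:C *: u n)
    ((v - u n) ** v + u n ** (v - u n)).
  have := nmD ((w *+ 2)%:C *: (v - u n)) ((w * (1 - Y n) *+ 2)%:C *: u n).
  have := nmD ((v - u n) ** v) (u n ** (v - u n)).
  lra.
- move=> c ac; apply/eqP; rewrite -subr_eq0; apply/eqP.
  apply: (@nm_lim0 _ _ _ (fun n => (1 - Y n) *+ 2) (2 * nm c)) => [|n|//].
    by have := nm_ge0 c; lra.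
  have -> : v ** c - c ** v = (v - u n) ** c - c ** (v - u n).
    by rewrite !cmulE (root_iter_comm n ac); module.
  apply: le_trans (nmB _ _) _.
  have := nmM (v - u n) c; have := nmM c (v - u n).
  have := ler_wpM2r (nm_ge0 c) (v_lim n); lra.
Qed.

End RootIteration.

(** * Positive elements, their roots, and Kaplansky's argument *)

Section Positivity.
Context {R : realType} {A : cstarAlgType R}.
Implicit Types (a b c g h p q s x y : A).

Lemma starM_complex p q : p^# ** q = q^# ** p ->
  (p + 'i *: q)^# ** (p + 'i *: q) = p^# ** p + q^# ** q.
Proof.
move=> pq; rewrite !cstarE !cmulE pq !scalerA.
have -> : 'i * 'i = -1 :> R[i] by rewrite -expr2 sqr_i.
by module.
Qed.

(** Both [p + i q] and [p - i q] have squared norm [nm (p^# ** p + q^# ** q)], and their difference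
    is [2 i q]. *)
Lemma nm_complexr p q k : 0 <= k -> p^# ** q = q^# ** p ->
  nm (p^# ** p + q^# ** q) <= k ^+ 2 -> nm q <= k.
Proof.
move=> k_ge0 pq le_k.
have plus : nm (p + 'i *: q) <= k.
  by rewrite -(ler_pXn2r (ltn0Sn 1)) ?nnegrE ?nm_ge0 // -nm_starM starM_complex.
have minus : nm (p + 'i *: (- q)) <= k.
  rewrite -(ler_pXn2r (ltn0Sn 1)) ?nnegrE ?nm_ge0 // -nm_starM starM_complex.
    by rewrite !cstarE !cmulE opprK.
  by rewrite !cstarE !cmulE pq.
rewrite -nmZi; apply: (@nm_half _ _ _ (p + 'i *: q - (p + 'i *: - q))).
  by module.
by apply: le_trans (nmB _ _) _; rewrite mulr2n lerD.
Qed.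

(* [h + i (1 - v)] and [h - i (1 - v)] are unitary if [(1 - v)^2 = 1 - h^2]. *)
Lemma nm_one_sub_sqr h b : h^# = h -> nm h <= 1 -> nm (b - h ** h ** b) <= nm b.
Proof.
move=> sh h_le1.
have hh_sa : (h ** h)^# = h ** h by rewrite cstarM sh.
have act_le c : nm (unital_act 0 (h ** h) c) <= nm c.
  rewrite /unital_act scale0r add0r; apply: le_trans (nmM _ _) _.
  rewrite ler_piMl ?nm_ge0 // nm_sqr // expr_le1 ?nm_ge0 //.
(* For [w = 0] the equation is [2 v = h^2 + v^2], that is [(1 - v)^2 = 1 - h^2]. *)
have [v [sv _ eqv comm]] := root_exists hh_sa (mulr0 0) act_le.
have vh : v ** h = h ** v by apply: comm; rewrite cmulA.
rewrite mul0rn scale0r addr0 in eqv.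
have contr c : nm (c - v ** c) <= nm c.
  (* With [p = h c] and [q = (1 - v) c], the sum [p^# p + q^# q] is [c^# c]. *)
  apply: (@nm_complexr (h ** c)); first exact: nm_ge0.
    rewrite !cstarE sv sh !cmulE -[c^# ** v ** h]cmulA vh cmulA; module.
  rewrite -nm_starM !cstarE sv sh !cmulE.
  have -> : c^# ** h ** h ** c = c^# ** v ** c *+ 2 - c^# ** v ** v ** c.
    have -> : c^# ** h ** h ** c = c^# ** (h ** h) ** c by rewrite !cmulA.
    have -> : h ** h = v *+ 2 - v ** v by rewrite eqv addrK.
    by rewrite !cmulE.
  rewrite le_eqVlt; apply/orP; left; apply/eqP; congr nm; module.
have -> : b - h ** h ** b = (b - v ** b) - v ** (b - v ** b).
  have -> : h ** h = v *+ 2 - v ** v by rewrite eqv addrK.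
  by cstar_ring.
exact: le_trans (contr _) (contr _).
Qed.

Lemma nm_sqr_sub_sqr h b (k : R) : h^# = h -> nm h <= k ->
  nm ((k ^+ 2)%:C *: b - h ** h ** b) <= k ^+ 2 * nm b.
Proof.
move=> sh h_le; have [k_le0|k_gt0] := lerP k 0.
  have -> : h = 0 by apply: nm_le0; apply: le_trans k_le0.
  have -> : k = 0 by apply/le_anti; rewrite k_le0 (le_trans (nm_ge0 h)).
  by rewrite expr0n !cmul0l scale0r subr0 nm0 mul0r.
have le1 : nm ((k^-1)%:C *: h) <= 1.
  by rewrite nmZR ger0_norm ?invr_ge0 ?(ltW k_gt0) // ler_pdivrMl // mulr1.
have sa1 : ((k^-1)%:C *: h)^# = (k^-1)%:C *: h by rewrite cstarE sh.
have := nm_one_sub_sqr ((k ^+ 2)%:C *: b) sa1 le1.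
rewrite nmZR ger0_norm ?exprn_ge0 ?(ltW k_gt0) //; apply: le_trans.
rewrite le_eqVlt; apply/orP; left; apply/eqP; congr (nm (_ - _)).
rewrite !cmulE !scalerA.
have -> : (k ^+ 2)%:C * (k^-1)%:C * (k^-1)%:C = 1 :> R[i].
  by rewrite -!rmorphM /= expr2 !mulfK ?mulfV ?gt_eqF // rmorph1.
by rewrite scale1r.
Qed.

(* Positivity is read off the spectral radius: [|t - a| <= t] as left
   multiplication operators. *)
Definition spos a : Prop := a^# = a /\
  exists2 t : R, 0 < t & forall b, nm (t%:C *: b - a ** b) <= t * nm b.

Lemma spos_sa a : spos a -> a^# = a.
Proof. by case. Qed.

Lemma spos0 : spos 0.
Proof.
split; first exact: cstar0.
by exists 1 => // b; rewrite cmul0l scale1r subr0 mul1r.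
Qed.

Lemma sposD a b : spos a -> spos b -> spos (a + b).
Proof.
case=> sa [s s_gt0 sP] [sb [t t_gt0 tP]]; split; first by rewrite cstarD sa sb.
exists (s + t) => [|c]; first exact: addr_gt0.
have -> : (s + t)%:C *: c - (a + b) ** c =
  (s%:C *: c - a ** c) + (t%:C *: c - b ** c) by cstar_ring.
by rewrite mulrDl (le_trans (nmD _ _)) ?lerD.
Qed.

Lemma sposZ (k : R) a : 0 <= k -> spos a -> spos (k%:C *: a).
Proof.
rewrite le_eqVlt => /predU1P[<- _|k_gt0].
  by rewrite scale0r; exact: spos0.
case=> sa [s s_gt0 sP]; split; first by rewrite cstarE sa.
exists (k * s) => [|c]; first exact: mulr_gt0.
have -> : (k * s)%:C *: c - (k%:C *: a) ** c = k%:C *: (s%:C *: c - a ** c).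
  by cstar_ring.
by rewrite nmZR ger0_norm ?(ltW k_gt0) // -mulrA ler_pM2l.
Qed.

Lemma spos_sqr h : h^# = h -> spos (h ** h).
Proof.
move=> sh; split; first by rewrite cstarM sh.
(* Adding 1 keeps the radius positive when [h = 0]. *)
have h1_gt0 : 0 < nm h + 1 by rewrite ltr_wpDl ?nm_ge0.
exists ((nm h + 1) ^+ 2) => [|b]; first exact: exprn_gt0.
by apply: nm_sqr_sub_sqr => //; rewrite lerDl.
Qed.

(** Applied to [w = 1] and [- a / t], [root_exists] yields [v^2 = a / t]. The root is
    [- sqrt t * v], and it is positive because [1 + v] is contractive. *)
Lemma spos_root a : spos a -> exists s,
  [/\ spos s, s ** s = a & forall c, a ** c = c ** a -> s ** c = c ** s].
Proof.
case=> sa [t t_gt0 tP].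
have sa' : ((- t^-1)%:C *: a)^# = (- t^-1)%:C *: a by rewrite cstarE sa.
have act_le c : nm (unital_act 1 ((- t^-1)%:C *: a) c) <= nm c.
  rewrite /unital_act.
  have -> : 1%:C *: c + (- t^-1)%:C *: a ** c
      = (t^-1)%:C *: (t%:C *: c - a ** c).
    rewrite scalerBr scalerA -rmorphM /= mulVf ?gt_eqF //; cstar_ring.
  by rewrite nmZR ger0_norm ?invr_ge0 ?(ltW t_gt0) // ler_pdivrMl.
have [v [sv v_le eqv comm]] := root_exists sa' (mulr1 1) act_le.
have vv : v ** v = (t^-1)%:C *: a.
  have -> : v ** v = v *+ 2 - ((- t^-1)%:C *: a + (1 *+ 2)%:C *: v).
    by rewrite [in RHS]eqv; module.
  by module.
have t_sqrt : Num.sqrt t * Num.sqrt t = t by rewrite -expr2 sqr_sqrtr ?ltW.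
exists ((- Num.sqrt t)%:C *: v); split.
- split; first by rewrite cstarE sv.
  exists (Num.sqrt t) => [|b]; first by rewrite sqrtr_gt0.
  have -> : (Num.sqrt t)%:C *: b - (- Num.sqrt t)%:C *: v ** b
     = (Num.sqrt t)%:C *: unital_act 1 v b by rewrite /unital_act; cstar_ring.
  by rewrite nmZR ger0_norm ?sqrtr_ge0 // ler_wpM2l ?sqrtr_ge0.
- rewrite !cmulE vv !scalerA -!rmorphM /= mulrNN t_sqrt.
  by rewrite mulfV ?gt_eqF // scale1r.
- move=> c ac; rewrite !cmulE comm // !cmulE ac.
  by [].
Qed.

(* [(c^2 - x^2)^2 + (2 c x)^2 = (c^2 + x^2)^2] with c = |x|. *)
Lemma nm_sqr_le_sum_le x y : x^# = x -> y^# = y -> nm y <= nm x ->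
  nm (x ** x) <= nm (x ** x + y ** y).
Proof.
move=> sx sy yx; set k := nm (x ** x + y ** y); set c := nm x.
have k_ge0 : 0 <= k := nm_ge0 _; have c_ge0 : 0 <= c := nm_ge0 _.
have plus_le b : nm ((c ^+ 2)%:C *: b + x ** x ** b) <= (k + c ^+ 2) * nm b.
  have -> : (c ^+ 2)%:C *: b + x ** x ** b = (x ** x + y ** y) ** b
     + ((c ^+ 2)%:C *: b - y ** y ** b) by cstar_ring.
  rewrite mulrDl (le_trans (nmD _ _)) // lerD ?nmM //.
  exact: nm_sqr_sub_sqr.
have x_le b : nm ((c *+ 2)%:C *: (x ** b)) <= (k + c ^+ 2) * nm b.
  apply: (@nm_complexr ((c ^+ 2)%:C *: b - x ** x ** b)).
  - by rewrite mulr_ge0 ?nm_ge0 // addr_ge0 // exprn_ge0.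
  - by rewrite !cstarE !cmulE !sx; module.
  apply: le_trans (_ : nm ((c ^+ 2)%:C *: b + x ** x ** b) ^+ 2 <= _).
    rewrite -nm_starM le_eqVlt; apply/orP; left; apply/eqP; congr nm.
    by rewrite !cstarE !cmulE !sx; module.
  rewrite ler_pXn2r ?nnegrE ?nm_ge0 ?plus_le // mulr_ge0 ?nm_ge0 //.
  by rewrite addr_ge0 // exprn_ge0.
have : nm ((c *+ 2)%:C *: x) <= k + c ^+ 2.
  apply: nm_le_op => [|b]; first by rewrite addr_ge0 // exprn_ge0.
  by rewrite cmulZl.
(* The bound now reads [2 c^2 <= k + c^2]. *)
rewrite nmZR ger0_norm ?mulrn_wge0 // nm_sqr // -/c; nra.
Qed.

Lemma nm_sqr_le_sum x y : x^# = x -> y^# = y ->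
  nm (x ** x) <= nm (x ** x + y ** y).
Proof.
move=> sx sy; have [yx|/ltW xy] := lerP (nm y) (nm x).
  exact: nm_sqr_le_sum_le.
apply: (@le_trans _ _ (nm (y ** y))).
  by rewrite !nm_sqr // ler_pXn2r ?nnegrE ?nm_ge0.
by rewrite addrC nm_sqr_le_sum_le.
Qed.

Lemma spos_nm_le a b : spos a -> spos b -> nm a <= nm (a + b).
Proof.
move=> /spos_root[s [/spos_sa ss <- _]] /spos_root[t [/spos_sa st <- _]].
exact: nm_sqr_le_sum.
Qed.

Lemma spos_add_eq0 a b : spos a -> spos b -> a + b = 0 -> a = 0.
Proof.
by move=> pa pb ab; apply: nm_le0; rewrite -(@nm0 R A) -ab spos_nm_le.
Qed.

(* n = |g| - g is twice the negative part of g. *)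
Lemma neg_part g : g^# = g -> exists n,
  [/\ n^# = n, spos (- (n ** g ** n)) & n ** g ** n = 0 -> spos g].
Proof.
move=> sg; have [m [pm mm comm_m]] := spos_root (spos_sqr sg).
have [r [pr rr comm_r]] := spos_root pm.
have mg : m ** g = g ** m by apply: comm_m; rewrite cmulA.
have rn : r ** (m - g) = (m - g) ** r.
  by apply: comm_r; rewrite !cmulE mg.
have sn : (m - g)^# = m - g by rewrite !cstarE sg (spos_sa pm).
have srn : (r ** (m - g))^# = r ** (m - g).
  by rewrite cstarM sn (spos_sa pr) rn.
(* With [n = m - g], [n ** g = - (m ** n)] follows from [m ** m = g ** g]; then [m = r ** r] is
   shared between the two factors [n]. *)
have eqrn : - ((m - g) ** g ** (m - g)) = (r ** (m - g)) ** (r ** (m - g)).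
  have -> : (r ** (m - g)) ** (r ** (m - g)) = m ** ((m - g) ** (m - g)).
    move: (m - g) rn => n rn; rewrite -rr -!cmulA; congr (r ** _).
    by rewrite !cmulA rn.
  rewrite !cmulE.
  have e1 : m ** m ** m = g ** g ** m by rewrite mm.
  have e2 : m ** m ** g = g ** g ** g by rewrite mm.
  have e3 : m ** g ** m = g ** g ** g by rewrite mg -cmulA mm cmulA.
  have e4 : m ** g ** g = g ** g ** m by rewrite mg -cmulA mg cmulA.
  rewrite e1 e2 e3 e4; module.
exists (m - g); split=> //; first by rewrite eqrn; apply: spos_sqr.
move=> ngn; have rn0 : r ** (m - g) = 0.
  by apply: cmul_sqr_eq0 => //; rewrite -eqrn ngn oppr0.
have mn0 : m ** (m - g) = 0 by rewrite -{1}rr -cmulA rn0 cmul0r.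
(* It remains to see that [g] is its own absolute value [m]; the square of [m - g] is
   [2 m (m - g) = 0]. *)
suff : m - g = 0 by move/eqP; rewrite subr_eq0 => /eqP <-.
apply: cmul_sqr_eq0 => //.
have -> : (m - g) ** (m - g) = (m ** (m - g)) *+ 2.
  by rewrite !cmulE mg -mm; module.
by rewrite mn0 mul0rn.
Qed.

(** First [y ** y^#] is positive as well; call its root [r]. The square of [y^# ** r ** y] is the
    cube of [y^# ** y = - g^2], that is [- (g^3)^2]. Two positive squares then sum to 0, so
    [g = 0]. *)
Lemma spos_opp_starM y : spos (- (y^# ** y)) -> y = 0.
Proof.
move=> py; have [g [/spos_sa sg gg _]] := spos_root py.
have pyy : spos (y ** y^#).
  have sp : (y + y^#)^# = y + y^# by rewrite !cstarE addrC.
  have sq : ('i *: (y - y^#))^# = 'i *: (y - y^#) by rewrite !cstarE; module.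
  (* Half the sum of the two squares is [y ** y^# + y^# ** y]; adding [- (y^# ** y)] leaves
     [y ** y^#]. *)
  have := sposD (sposZ (k := 2^-1) _ (sposD (spos_sqr sp) (spos_sqr sq))) py.
  rewrite invr_ge0 ler0n => /(_ isT).
  set lhs := (X in spos X -> _); suff -> : lhs = y ** y^# by [].
  have ii (z : A) : ('i *: z) ** ('i *: z) = - (z ** z).
    by rewrite cmulZl cmulZr scalerA -expr2 sqr_i scaleN1r.
  have sum2 : (y + y^#) ** (y + y^#) + ('i *: (y - y^#)) ** ('i *: (y - y^#))
      = (y ** y^# + y^# ** y) *+ 2 by rewrite ii; cstar_ring.
  by rewrite /lhs sum2 scale_half addrK.
have [r [/spos_sa sr rr _]] := spos_root pyy.
have sx : (y^# ** r ** y)^# = y^# ** r ** y by rewrite !cstarE sr cmulA.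
have xx : (y^# ** r ** y) ** (y^# ** r ** y) =
    - ((g ** g ** g) ** (g ** g ** g)).
  have -> : (g ** g ** g) ** (g ** g ** g) = (g ** g) ** (g ** g) ** (g ** g).
    by rewrite !cmulA.
  have -> : (y^# ** r ** y) ** (y^# ** r ** y) =
     y^# ** (r ** (y ** y^#) ** r) ** y by rewrite !cmulA.
  have -> : r ** (y ** y^#) ** r = (y ** y^#) ** (y ** y^#).
    by rewrite -rr !cmulA.
  by rewrite gg !cmulE !opprK.
have sggg : (g ** g ** g)^# = g ** g ** g by rewrite !cstarE sg cmulA.
have ggg0 : g ** g ** g = 0.
  apply: cmul_sqr_eq0 => //.
  apply: (spos_add_eq0 (spos_sqr sggg) (spos_sqr sx)).
  by rewrite xx subrr.
have gg0 : g ** g = 0.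
  by apply: cmul_sqr_eq0; rewrite ?cstarM ?sg // cmulA ggg0 cmul0l.
apply: cmul_starl_eq0; rewrite gg0 in gg.
by apply/eqP; rewrite -oppr_eq0 -gg.
Qed.

(** For [n] given by [neg_part], [spos_opp_starM] applies to [a ** n] and yields [a ** n = 0], so
    [n ** (a^# ** a) ** n] vanishes. *)
Lemma spos_starM a : spos (a^# ** a).
Proof.
have sg : (a^# ** a)^# = a^# ** a by rewrite cstarM cstarK.
have [n [sn pn]] := neg_part sg; apply.
have eqn : n ** (a^# ** a) ** n = (a ** n)^# ** (a ** n).
  by rewrite cstarM sn !cmulA.
rewrite eqn in pn *; by rewrite (spos_opp_starM pn) cmul0r.
Qed.

Lemma cposP a : cpos a <-> spos a.
Proof.
split=> [[b ->]|/spos_root[s [/spos_sa ss <- _]]]; first exact: spos_starM.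
by exists s; rewrite ss.
Qed.

Lemma cle_nm a b : 0 <=* a -> a <=* b -> nm a <= nm b.
Proof.
rewrite /cle subr0 => /cposP pa /cposP pab.
by rewrite -[b](subrK a) addrC spos_nm_le.
Qed.

Lemma spos_conj a c : spos a -> spos (c^# ** a ** c).
Proof.
move=> /spos_root[s [/spos_sa ss <- _]].
have -> : c^# ** (s ** s) ** c = (s ** c)^# ** (s ** c).
  by rewrite cstarM ss !cmulA.
exact: spos_starM.
Qed.

Lemma cle_conj a b c : a <=* b -> c^# ** a ** c <=* c^# ** b ** c.
Proof.
move=> /cposP /(spos_conj c); rewrite !cmulE => p.
by apply/cposP.
Qed.

(** Let [g = (M + 1) q - p] and take [n] from [neg_part]. Then [n p n] is [(M + 1) n q n] plus the
    positive [- n g n], whence [(M + 1) |n q n| <= |n p n| <= M |n q n|]. The extra 1 forces both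
    norms to vanish. *)
Lemma cle_of_nm_conj (M : R) p q : spos p -> spos q -> 0 <= M ->
  (forall a, nm (a^# ** p ** a) <= M * nm (a^# ** q ** a)) ->
  p <=* (M + 1)%:C *: q.
Proof.
move=> pp pq M_ge0 le_pq; apply/cposP.
have sg : ((M + 1)%:C *: q - p)^# = (M + 1)%:C *: q - p.
  by rewrite !cstarE (spos_sa pp) (spos_sa pq).
have [n [sn pn]] := neg_part sg; apply.
have pnp := spos_conj n pp; have pnq := spos_conj n pq.
rewrite sn in pnp pnq.
have le1 := spos_nm_le (sposZ (addr_ge0 M_ge0 ler01) pnq) pn.
have eqn : (M + 1)%:C *: (n ** q ** n) - n ** ((M + 1)%:C *: q - p) ** n
  = n ** p ** n by cstar_ring.
rewrite eqn nmZR ger0_norm ?addr_ge0 // in le1.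
have := le_pq n; rewrite sn => le2.
have nqn0 : n ** q ** n = 0 by apply: nm_le0; lra.
have npn0 : n ** p ** n = 0.
  by apply: nm_le0; apply: le_trans le2 _; rewrite nqn0 nm0 mulr0.
by rewrite !cmulE npn0 nqn0 scaler0 subr0.
Qed.

Lemma cabs_sqr a : cabs a ** cabs a = a^# ** a.
Proof.
have [s [ps ss _]] := spos_root (spos_starM a).
(* The root [s] rules out the default value 0 of [xget]. *)
rewrite /cabs /csqrt; case: xgetP => [x _ [] //|/(_ s)].
by case; split=> //; apply/cposP.
Qed.

End Positivity.

(** * Roots of unity and Cauchy's estimate *)

Lemma prim_root_exists (F : closedFieldType) (n : nat) :
  n%:R != 0 :> F -> exists z : F, n.-primitive_root z.
Proof.
move=> nF_neq0; have n_gt0 : (0 < n)%N by case: n nF_neq0 => //; rewrite eqxx.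
have [rs eq_rs] := closed_field_poly_normal ('X^n - 1 : {poly F}).
rewrite (monicP _) ?monicXnsubC // scale1r in eq_rs.
have rs_n : all n.-unity_root rs.
  by apply/allP=> z; rewrite -root_prod_XsubC -eq_rs.
have sz_rs : (n < (size rs).+1)%N.
  by rewrite -(size_prod_XsubC rs id) -eq_rs size_XnsubC.
have [|z] := hasP (has_prim_root n_gt0 rs_n _ sz_rs); last by exists z.
(* The roots are distinct: [X^n - 1] is separable because [n] is nonzero in [F]. *)
by rewrite -separable_prod_XsubC -eq_rs separable_Xn_sub_1.
Qed.

(** Singles out degree 1 when averaging over [N]-th roots of unity, where the exponent [N.-1] stands
    for [-1]. *)
Lemma dvdn_pred_add N d : (1 < N)%N -> (d < N)%N ->
  (N %| N.-1 + d)%N = (d == 1%N).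
Proof.
case: N => [|[|N]] //; case: d => [|d] _ d_lt; first by rewrite addn0 gtnNdvd.
rewrite /= addnS -addSn dvdn_addr ?dvdnn //.
by case: d d_lt => [|d] d_lt; [rewrite dvdn0 | rewrite gtnNdvd // ltnW].
Qed.

Section Averaging.
Context {R : realType} {A : cstarAlgType R}.

Lemma prim_root_norm (n : nat) (z : R[i]) : n.-primitive_root z -> `|z| = 1.
Proof.
move=> zP; have n_gt0 := prim_order_gt0 zP.
apply/eqP; rewrite -(@pexpr_eq1 _ _ n) //.
by rewrite -normrX (prim_expr_order zP) normr1.
Qed.

Lemma nm_sum (I : Type) (s : seq I) (P : pred I) (F : I -> A) :
  nm (\sum_(i <- s | P i) F i) <= \sum_(i <- s | P i) nm (F i).
Proof.
elim/big_rec2: _ => [|i x y _ le_yx]; first by rewrite nm0.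
by rewrite (le_trans (nmD _ _)) // lerD2l.
Qed.

(* Cauchy's estimate, the integral being an average over roots of unity. *)
Lemma cauchy_estimate1 (I : finType) (d : I -> nat) (H : I -> A) (N : nat)
    (r B : R) : 0 < r -> (1 < N)%N -> (forall i, (d i < N)%N) ->
  (forall l : R[i], `|l| = r%:C -> nm (\sum_i l ^+ d i *: H i) <= B) ->
  r * nm (\sum_(i | d i == 1%N) H i) <= B.
Proof.
move=> r_gt0 N_gt1 d_lt le_B; have N_gt0 := ltnW N_gt1.
have [w wP] : exists w : R[i], N.-primitive_root w.
  by apply: prim_root_exists; rewrite pnatr_eq0 -lt0n.
have w1 := prim_root_norm wP.
pose g j := (w ^+ j) ^+ N.-1 *: \sum_i (r%:C * w ^+ j) ^+ d i *: H i.
have g_le j : nm (g j) <= B.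
  rewrite nmZ !normrX w1 !expr1n mul1r; apply: le_B.
  by rewrite normrM normrX w1 expr1n mulr1 ger0_norm // ler0c ltW.
have sum_g : \sum_(j < N) g j = (N%:R * r)%:C *: \sum_(i | d i == 1%N) H i.
  rewrite /g; under eq_bigr => j _ do rewrite scaler_sumr.
  rewrite exchange_big scaler_sumr [RHS]big_mkcond /=; apply: eq_bigr => i _.
  have -> : \sum_(j < N) (w ^+ j) ^+ N.-1 *: ((r%:C * w ^+ j) ^+ d i *: H i) =
      (\sum_(j < N) (w ^+ (N.-1 + d i)) ^+ j * r%:C ^+ d i) *: H i.
    rewrite scaler_suml; apply: eq_bigr => j _; rewrite scalerA; congr (_ *: _).
    by rewrite exprMn mulrCA mulrC -!exprM -exprD mulnDl ![(j * _)%N]mulnC.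
  rewrite -mulr_suml; case: eqP => [->|d_neq1].
    rewrite addn1 prednK // (prim_expr_order wP).
    under eq_bigr => j _ do rewrite expr1n.
    by rewrite sumr_const card_ord expr1 rmorphM /= rmorph_nat.
  (* An [N]-th root of unity other than 1 has vanishing geometric sum. *)
  suff -> : \sum_(j < N) (w ^+ (N.-1 + d i)) ^+ j = 0 by rewrite mul0r scale0r.
  set v := w ^+ (N.-1 + d i).
  have v_neq1 : v != 1.
    by rewrite /v -(prim_order_dvd wP) dvdn_pred_add //; apply/eqP.
  have : (v - 1) * \sum_(j < N) v ^+ j = 0.
    by rewrite -subrX1 /v exprAC (prim_expr_order wP) expr1n subrr.
  by move/eqP; rewrite mulf_eq0 subr_eq0 (negPf v_neq1) => /eqP.
have N_gt0R : 0 < N%:R :> R by rewrite ltr0n.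
have Nr_ge0 : 0 <= N%:R * r by apply/ltW/mulr_gt0.
rewrite -(ler_pM2l N_gt0R) mulrA -[X in X * _](ger0_norm Nr_ge0).
rewrite -nmZR -sum_g; apply: le_trans (nm_sum _ _ _) _.
have : \sum_(j < N) nm (g j) <= \sum_(j < N) B by apply: ler_sum => j _.
by rewrite sumr_const card_ord mulr_natl.
Qed.

Lemma linear_sumZ (U V : lmodType R[i]) (f : U -> V) (I : Type) (s : seq I)
    (P : pred I) (k : I -> R[i]) (v : I -> U) : linear f ->
  f (\sum_(i <- s | P i) k i *: v i) = \sum_(i <- s | P i) k i *: f (v i).
Proof.
move=> lin.
pose g : {linear U -> V} := HB.pack f (GRing.isLinear.Build _ _ _ _ f lin).
by rewrite -[f]/(g : U -> V) linear_sum; apply: eq_bigr => i _; rewrite linearZ.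
Qed.

(** The binomial theorem for the operator [1 + l f]; the induction step is Pascal's rule. *)
Lemma iter_binomial (V : lmodType R[i]) (f : V -> V) (l : R[i]) n v :
  linear f ->
  iter n (fun u => u + l *: f u) v =
  \sum_(i < n.+1) (l ^+ i *+ 'C(n, i)) *: iter i f v.
Proof.
move=> lin; elim: n => [|n IHn].
  by rewrite big_ord1 /= expr0 bin0 scale1r.
rewrite iterS {}IHn (linear_sumZ _ _ _ _ lin) scaler_sumr.
rewrite [X in _ + X](eq_bigr (fun i : 'I_n.+1 =>
   (l ^+ i.+1 *+ 'C(n, i)) *: iter i.+1 f v)); last first.
  by move=> i _; rewrite scalerA mulrnAr -exprS.
rewrite [RHS]big_ord_recl [X in X + _ = _]big_ord_recl /= !bin0 -addrA.
congr (_ + _).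
rewrite [RHS](eq_bigr (fun i : 'I_n.+1 =>
   (l ^+ i.+1 *+ 'C(n, i.+1)) *: iter i.+1 f v
   + (l ^+ i.+1 *+ 'C(n, i)) *: iter i.+1 f v)); last first.
  by move=> i _; rewrite binS mulrnDr scalerDl.
rewrite big_split /=; congr (_ + _).
by rewrite [RHS]big_ord_recr /= bin_small // mulr0n scale0r addr0.
Qed.

(* [u *>> c] for u = x (1 + l h)^n and c = (1 - l h)^n b is x (1 - l^2 h^2)^n b,
   which is bounded for [|l| = n^(-1/2)], while the coefficient of l in
   [F u c] is [n (F (x h) b - F x (h b))]. *)
Lemma bilinear_commutator_estimate (X : rightModType A) (F : X -> A -> A)
    (B : R) (x : X) (h b : A) (n : nat) (r : R) :
  (forall c, linear (F^~ c)) -> (forall u, linear (F u)) ->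
  0 < r -> (0 < n)%N -> 0 <= B ->
  (forall u c d, u *>> c = x *>> d -> nm (F u c) <= B * nm d) ->
  r * n%:R * nm (F (x *>> h) b - F x (h ** b)) <=
    B * (1 + r ^+ 2 * nm h ^+ 2) ^+ n * nm b.
Proof.
move=> linl linr r_gt0 n_gt0 B_ge0 F_le.
(* With the sign put into [g], [1 + l f] and [1 + l g] are the actions of [1 + l h] and
   [1 - l h]. *)
pose f (u : X) := u *>> h; pose g (c : A) := - (h ** c).
have lin_f : linear f by move=> k u v; rewrite /f ractDl ractZl.
have lin_g : linear g by move=> k u v; rewrite /g cmulDr cmulZr; module.
pose H (p : 'I_n.+1 * 'I_n.+1) :=
  ('C(n, p.1) * 'C(n, p.2))%:R *: F (iter p.1 f x) (iter p.2 g b).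
have bnd (l : R[i]) : `|l| = r%:C ->
    nm (\sum_(p : 'I_n.+1 * 'I_n.+1) l ^+ (p.1 + p.2) *: H p) <=
    B * ((1 + r ^+ 2 * nm h ^+ 2) ^+ n * nm b).
  move=> l_norm.
  have -> : \sum_(p : 'I_n.+1 * 'I_n.+1) l ^+ (p.1 + p.2) *: H p =
      F (iter n (fun u => u + l *: f u) x) (iter n (fun u => u + l *: g u) b).
    rewrite !iter_binomial // (linear_sumZ _ _ _ _ (linl _)).
    rewrite -(pair_bigA _ (fun i j : 'I_n.+1 => l ^+ (i + j) *: H (i, j))) /=.
    apply: eq_bigr => i _; rewrite (linear_sumZ _ _ _ _ (linr _)) scaler_sumr.
    apply: eq_bigr => j _; rewrite !scalerA; congr (_ *: _).
    by rewrite /= exprD mulrnAl mulrnAr -mulrnA mulr_natr mulnC.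
  pose d0 := iter n (fun u => u - (l ^+ 2) *: (h ** h ** u)) b.
  apply: le_trans (F_le _ _ d0 _) _.
    pose p (c : A) := c + l *: (h ** c).
    have act_iter c : iter n (fun u => u + l *: f u) x *>> c = x *>> iter n p c.
      elim: (n) c => // k IHk c; rewrite iterS iterSr -IHk /p /f.
      by rewrite ractDl ractDr -ractZl -ractA ractZr.
    rewrite act_iter; congr (_ *>> _); rewrite /d0.
    elim: (n) => // k IHk; rewrite !iterS -IHk.
    (* The factors [1 + l h] and [1 - l h] commute, so they pair off into [1 - l^2 h^2]. *)
    have comm c : iter k p (c + l *: g c) = iter k p c + l *: g (iter k p c).
      elim: (k) => // k' IHk'; rewrite !iterS IHk' /p /g.
      by cstar_ring.
    by rewrite comm /p /g; cstar_ring.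
  rewrite ler_wpM2l // /d0; elim: (n) => [|k IHk]; first by rewrite expr0 mul1r.
  rewrite iterS [_ ^+ k.+1]exprS -mulrA; move: IHk; set v := iter k _ b => IHk.
  apply: le_trans (nmB _ _) _; rewrite nmZ normrX l_norm -rmorphXn /=.
  have := nmM (h ** h) v; have := ler_wpM2r (nm_ge0 v) (nmM h h).
  have r2h2_ge0 := mulr_ge0 (sqr_ge0 r) (sqr_ge0 (nm h)).
  have := ler_wpM2l (addr_ge0 ler01 r2h2_ge0) IHk.
  have := sqr_ge0 r; set r2 := r ^+ 2; set K := _ ^+ k; nra.
(* The total degree is at most [2 n], so [2 n + 1] roots of unity suffice. *)
have d_lt (p : 'I_n.+1 * 'I_n.+1) : (p.1 + p.2 < (n + n).+1)%N.
  by rewrite ltnS leq_add // -ltnS ltn_ord.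
have N_gt1 : (1 < (n + n).+1)%N by rewrite ltnS addn_gt0 n_gt0.
have := cauchy_estimate1 r_gt0 N_gt1 d_lt bnd.
rewrite mulrA -[r * _ * _]mulrA; congr (_ * _ <= _).
case: n n_gt0 @H {bnd d_lt N_gt1} => // n _ H.
(* Total degree 1 comes only from the index pairs [(0, 1)] and [(1, 0)]. *)
rewrite (bigD1 (ord0, lift ord0 ord0)) //= (bigD1 (lift ord0 ord0, ord0)) //=.
rewrite big1 ?addr0; last first.
  case=> i j /=; rewrite !xpair_eqE -!val_eqE /=.
  by case: (val i) (val j) => [|[|i']] [|[|j']].
rewrite /H /= bin0 bin1 mul1n muln1 -scalerDr -(rmorph_nat (real_complex R)).
rewrite nmZR ger0_norm ?ler0n //; congr (_ * nm _).
have -> : g b = 0 - h ** b by rewrite sub0r.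
have linB (c d : A) : F x (c - d) = F x c - F x d.
  by have := linr x (-1) d c; rewrite !scaleN1r ![- _ + _]addrC.
by rewrite linB -(subrr 0) linB subrr sub0r addrC.
Qed.

End Averaging.

(** * Semi-inner product modules and the two implications *)

Section SemiInnerProduct.
Context {R : realType} {A : cstarAlgType R}.

Lemma sip_spos (X : sipModType A) (x : X) : spos (sip x x).
Proof. by apply/cposP; rewrite -[sip x x]subr0; exact: sip_ge0. Qed.

Lemma sip_linear (X : sipModType A) (z : X) : linear (sip z).
Proof. by move=> k u v; rewrite -[v in LHS]scale1r sip_linr scale1r. Qed.

Lemma sip0r (X : sipModType A) (z : X) : sip z 0 = 0.
Proof.
rewrite -[X in sip z X](subrr 0) -scaleN1r addrC.
by rewrite sip_linear scaleN1r addNr.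
Qed.

(** The norm is monotone on positive elements, which turns the operator Cauchy-Schwarz inequality
    into a scalar one. *)
Lemma nm_sip_sqr (X : sipModType A) (x y : X) :
  nm (sip y x) ^+ 2 <= nm (sip y y) * nm (sip x x).
Proof.
have := sip_CauchySchwarz x y; rewrite cabs_sqr nmE => /cle_nm.
rewrite nm_starM nmZR ger0_norm ?nm_ge0 //; apply.
by rewrite /cle subr0; apply/cposP/spos_starM.
Qed.

Lemma sip_act (X : sipModType A) (x : X) (a : A) :
  sip (x *>> a) (x *>> a) = a^# ** sip x x ** a.
Proof. by rewrite sip_actr sip_actl. Qed.

Lemma nm_sip_act (X : sipModType A) (x : X) (a : A) :
  nm (sip (x *>> a) (x *>> a)) <= nm (sip x x) * nm a ^+ 2.
Proof.
rewrite sip_act; apply: le_trans (nmM _ _) _.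
by rewrite expr2 mulrA ler_wpM2r ?nm_ge0 // mulrC -(nm_star a) nmM.
Qed.

Lemma sip_normE (X : sipModType A) (x : X) :
  sip_norm x = (Num.sqrt (nm (sip x x)))%:C.
Proof.
rewrite /sip_norm nmE -{1}(sqr_sqrtr (nm_ge0 (sip x x))) rmorphXn /=.
by rewrite sqrCK // ler0c sqrtr_ge0.
Qed.

Variables (X Y : sipModType A) (T : {linear X -> Y}).

Lemma sip_bounded_of_cle (K : R) : 0 <= K ->
  (forall x, sip (T x) (T x) <=* K%:C *: sip x x) -> sip_bounded T.
Proof.
move=> K_ge0 le_T; exists (Num.sqrt K) => x.
rewrite !sip_normE -rmorphM /= -sqrtrM // lecR ler_wsqrtr //.
have := cle_nm _ (le_T x); rewrite nmZR ger0_norm //; apply.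
exact: sip_ge0.
Qed.

(** Squaring makes the constant nonnegative, as [sip_bounded] prescribes no sign. *)
Lemma sip_bounded_sqr : sip_bounded T -> exists2 M : R, 0 <= M &
  forall x, nm (sip (T x) (T x)) <= M * nm (sip x x).
Proof.
case=> M le_T; exists (M ^+ 2) => [|x]; first exact: sqr_ge0.
have := le_T x; rewrite !sip_normE -rmorphM lecR => le_M.
rewrite -(sqr_sqrtr (nm_ge0 (sip (T x) (T x)))).
rewrite -[X in _ <= _ * X](sqr_sqrtr (nm_ge0 (sip x x))) -exprMn.
rewrite ler_pXn2r // nnegrE ?sqrtr_ge0 //.
by apply: le_trans le_M; exact: sqrtr_ge0.
Qed.

(** By A-linearity, conjugating [sip (T x) (T x)] by [a] gives [sip (T (x *>> a)) (T (x *>> a))], to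
    which boundedness applies. *)
Lemma cle_of_bounded : sip_bounded T ->
  (forall x a, T (x *>> a) = T x *>> a) ->
  exists K : R, 0 <= K /\ forall x, sip (T x) (T x) <=* K%:C *: sip x x.
Proof.
move=> /sip_bounded_sqr[M M_ge0 le_T] T_act; exists (M + 1).
split=> [|x]; first by rewrite addr_ge0.
apply: cle_of_nm_conj => // [||a]; [exact: sip_spos..|].
by rewrite -!sip_act -T_act.
Qed.

(** After Cauchy-Schwarz, conjugating the hypothesis at [u] by [c] bounds [T u *>> c] through
    [u *>> c], without moving [c] inside [T]. *)
Lemma act_bounded_of_cle (K : R) : 0 <= K ->
  (forall x, sip (T x) (T x) <=* K%:C *: sip x x) ->
  forall (z : Y) (x u : X) (c d : A), u *>> c = x *>> d ->
  nm (sip z (T u *>> c)) <=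
    Num.sqrt (nm (sip z z) * (K * nm (sip x x))) * nm d.
Proof.
move=> K_ge0 le_T z x u c d eq_uc.
have zK_ge0 : 0 <= nm (sip z z) * (K * nm (sip x x)).
  by rewrite !mulr_ge0 ?nm_ge0.
rewrite -(ler_pXn2r (ltn0Sn 1)) ?nnegrE ?mulr_ge0 ?sqrtr_ge0 ?nm_ge0 //.
rewrite exprMn sqr_sqrtr //; apply: le_trans (nm_sip_sqr _ _) _.
rewrite -!mulrA ler_wpM2l ?nm_ge0 //.
have le1 : nm (sip (T u *>> c) (T u *>> c)) <= K * nm (sip (u *>> c) (u *>> c)).
  rewrite !sip_act -[K in leRHS]ger0_norm // -nmZR -cmulZl -cmulZr.
  apply: cle_nm; last exact: cle_conj.
  by rewrite /cle subr0; apply/cposP; apply: spos_conj; exact: sip_spos.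
by apply: le_trans le1 _; rewrite eq_uc ler_wpM2l ?nm_sip_act.
Qed.

Lemma module_linear_of_cle (K : R) : 0 <= K ->
  (forall x, sip (T x) (T x) <=* K%:C *: sip x x) ->
  forall x a, T (x *>> a) = T x *>> a.
Proof.
move=> K_ge0 le_T x h; apply/eqP; rewrite -subr_eq0; apply/eqP.
(* For every [b], [sip y y ** b = sip y (y *>> b) = 0]; this replaces evaluation at a unit. *)
have act0 (y : Y) : (forall b, y *>> b = 0) -> y = 0.
  move=> y_b; apply: sip_eq0; apply: cabsorb_eq0 => b.
  by rewrite -sip_actr y_b sip0r.
apply: act0 => b; set z := _ *>> b.
(* The first variable of [sip] need not be additive, so it is frozen at [z]. *)
pose F (u : X) (c : A) := sip z (T u *>> c).
have linl c : linear (F^~ c).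
  by move=> k u v; rewrite /F linearP ractDl -ractZl sip_linear.
have linr u : linear (F u).
  by move=> k c d; rewrite /F ractDr -ractZr sip_linear.
have ZF : F (x *>> h) b - F x (h ** b) = sip z z.
  rewrite /F ractA addrC -scaleN1r -sip_linear; congr (sip z _).
  by rewrite ractZl -ractDl scaleN1r addrC.
set B := Num.sqrt (nm (sip z z) * (K * nm (sip x x))).
have B_ge0 : 0 <= B := sqrtr_ge0 _.
have F_le u c d : u *>> c = x *>> d -> nm (F u c) <= B * nm d.
  exact: act_bounded_of_cle.
have bnd m : m.+1%:R * nm (sip z z) <= B * expR (nm h ^+ 2) * nm b.
  have m_gt0 : 0 < m.+1%:R :> R by rewrite ltr0n.
  have mV_gt0 : 0 < m.+1%:R^-1 :> R by rewrite invr_gt0.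
  have mm_gt0 : (0 < m.+1 * m.+1)%N by [].
  (* Radius [r = 1 / (m + 1)] and exponent [n = (m + 1)^2] give [r n = m + 1] and [r^2 n = 1]. *)
  have := bilinear_commutator_estimate h b linl linr mV_gt0 mm_gt0 B_ge0 F_le.
  rewrite ZF natrM mulKf ?gt_eqF // => /le_trans; apply.
  rewrite ler_wpM2r ?nm_ge0 // ler_wpM2l //.
  (* Since [r^2 n = 1], the bound [1 + s <= exp s] at [s = r^2 |h|^2] has the [n]-th power
     [(1 + s)^n <= exp (|h|^2)]. *)
  have -> : expR (nm h ^+ 2) =
      expR (m.+1%:R^-1 ^+ 2 * nm h ^+ 2) ^+ (m.+1 * m.+1).
    rewrite -expRM_natl; congr expR; rewrite natrM -expr2 mulrA -exprMn.
    by rewrite mulfV ?gt_eqF // expr1n mul1r.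
  have le_exp := expR_ge1Dx (m.+1%:R^-1 ^+ 2 * nm h ^+ 2).
  rewrite lerXn2r // nnegrE ?expR_ge0 // addr_ge0 //.
  by rewrite mulr_ge0 ?sqr_ge0.
apply: sip_eq0; apply: nm_eq0; apply/eqP/negPn/negP => zz_neq0.
have zz_gt0 : 0 < nm (sip z z) by rewrite lt0r zz_neq0 nm_ge0.
(* An integer [m + 1] beyond this ratio contradicts [bnd]. *)
pose t := B * expR (nm h ^+ 2) * nm b / nm (sip z z).
have := truncnS_gt t; rewrite ltr_pdivrMr // => /lt_le_trans/(_ (bnd _)).
by rewrite ltxx.
Qed.

End SemiInnerProduct.


Theorem theorem4p4 (R : realType) (A : cstarAlgType R) (X Y : sipModType A)
    (T : {linear X -> Y}) :
  (sip_bounded T /\ (forall (x : X) (a : A), T (x *>> a) = T x *>> a)) <->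
  (exists K : R, 0 <= K /\
    forall x : X, sip (T x) (T x) <=* K%:C *: sip x x).
Proof.
split=> [[bT T_act]|[K [K_ge0 le_T]]]; first exact: cle_of_bounded.
split; first exact: sip_bounded_of_cle K_ge0 le_T.
exact: module_linear_of_cle K_ge0 le_T.
Qed.
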